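(* Every finite affine plane is super-neat: if $D$ is a $2$-$(q^2,q,1)$ design with $q\geq 2$, then every minimum dominating set of the incidence graph of $D$ is neat.
   Context: A $2$-$(v,k,\lambda)$ design $D=(X,\mathcal{B})$ consists of a set $X$ of $v$ points and a family $\mathcal{B}$ of $k$-subsets (blocks) such that every pair of distinct points lies in exactly $\lambda$ blocks. The incidence graph $G_D$ has vertex set $X\cup\mathcal{B}$ with $x$ adjacent to $B$ iff $x\in B$. A dominating set is a set $S$ of vertices such that every vertex not in $S$ is adjacent to some vertex of $S$; $\gamma(D)$ is the minimum size of a dominating set of $G_D$, and a minimum dominating set is one of size $\gamma(D)$. For $P\subseteq X$, $\hat{L}(P)=\{B\in\mathcal{B}:B\cap P=\emptyset\}$ and $I_P=P\cup\hat{L}(P)$. A set $S$ is neat if $S=I_P$ for some $P\subseteq X$. $D$ is super-neat if every minimum dominating set of $G_D$ is neat. *)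

(* Defs.v *)
From mathcomp Require Import all_boot.

Set Implicit Arguments.
Unset Strict Implicit.
Unset Printing Implicit Defensive.

Section Domination.

Variables (T : finType) (e : rel T).

Definition dominating (S : {set T}) : bool :=
  [forall u, (u \notin S) ==> [exists w in S, e u w]].

Lemma dominatingT : dominating [set: T].
Proof. by apply/forallP => u; rewrite inE. Qed.

Definition domination_number : nat :=
  #|[arg min_(S < [set: T] | dominating S) #|S|]|.

Lemma domination_number_le (S : {set T}) :
  dominating S -> domination_number <= #|S|.
Proof.
rewrite /domination_number; case: arg_minnP => [|M _ minM]; last exact: minM.
exact: dominatingT.
Qed.

Definition minimum_dominating (S : {set T}) : bool :=
  dominating S && (#|S| == domination_number).

End Domination.

(* The block family is indexed: a set B of blocks is the case where I is the  *)
(* subtype of members of B and blk is val. An arbitrary I also allows         *)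
(* repeated blocks, which then are distinct vertices of the incidence graph.  *)
Section Designs.

Variables (X I : finType) (blk : I -> {set X}).

Definition is_2design (v k lambda : nat) : Prop :=
  [/\ #|X| = v,
      forall i : I, #|blk i| = k
    & forall x y : X, x != y ->
        #|[set i : I | (x \in blk i) && (y \in blk i)]| = lambda].

Definition incidence_graph : rel (X + I) := fun u w =>
  match u, w with
  | inl x, inr i => x \in blk i
  | inr i, inl x => x \in blk i
  | _, _ => false
  end.

Definition missed_blocks (P : {set X}) : {set I} :=
  [set i : I | blk i :&: P == set0].

Definition neat_set (P : {set X}) : {set X + I} :=
  [set inl x | x in P] :|: [set inr i | i in missed_blocks P].

Definition neat (S : {set X + I}) : Prop :=
  exists P : {set X}, S = neat_set P.

Definition super_neat : Prop :=
  forall S : {set X + I}, minimum_dominating incidence_graph S -> neat S.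

End Designs.

(* Main.v *)
Require Import Defs.
From mathcomp Require Import all_boot zify.

(** Let S = P + L be a minimum dominating set, with P points and L blocks. A
    block together with its parallels is dominating, so |P| + |L| <= 2q - 1.
    All blocks missing P lie in L, and at most 1 + |P| q blocks meet P; this
    forces |P| >= q, hence |L| <= q - 1. But L covers the q^2 - |P| points
    outside P, and blocks have q points, so there is no room for a block of L
    that meets P: L consists exactly of the blocks missing P. *)

Section AffinePlane.

Variables (q : nat) (X I : finType) (blk : I -> {set X}).
Hypotheses (q_ge2 : 2 <= q) (affine_plane : is_2design blk (q ^ 2) q 1).

(** Double counting of the incidences between [A] and [P]; the later counts are instances of it. *)
Lemma sum_card_blk (A : {set I}) (P : {set X}) :
  \sum_(i in A) #|blk i :&: P| = \sum_(x in P) #|[set i in A | x \in blk i]|.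
Proof.
transitivity (\sum_(i in A) \sum_(x in P) (x \in blk i)).
  apply: eq_bigr => i _; rewrite setIC -sum1_card.
  rewrite (eq_bigl (fun x => (x \in P) && (x \in blk i))) => [|x]; last by rewrite inE.
  by rewrite big_mkcondr; apply: eq_bigr => x _; case: (x \in blk i).
rewrite exchange_big; apply: eq_bigr => x _; rewrite -sum1dep_card big_mkcondr.
by apply: eq_bigr => i _; case: (x \in blk i).
Qed.

Lemma card_star (x : X) : #|[set i | x \in blk i]| = q.+1.
Proof.
have [cX cB c2] := affine_plane.
have := sum_card_blk [set i | x \in blk i] (~: [set x]).
rewrite (eq_bigr (fun=> q.-1)) => [|i]; last first.
  rewrite inE => xi; rewrite -setDE; have := cardsD1 x (blk i).
  by rewrite xi cB; lia.
rewrite [RHS](eq_bigr (fun=> 1)) => [|y]; last first.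
  rewrite !inE eq_sym => /c2 <-.
  by apply: eq_card => i; rewrite !inE.
rewrite sum_nat_const sum1_card => E.
(* With r blocks through [x], [E] yields r(q - 1) = q^2 - 1, and q - 1 > 0 cancels. *)
have := cardsC1 x; rewrite cX; nia.
Qed.

Lemma card_blocks : #|I| = q * q.+1.
Proof.
have [cX cB _] := affine_plane.
have := sum_card_blk setT setT.
rewrite (eq_bigr (fun=> q)) => [|i _]; last by rewrite setIT cB.
rewrite [RHS](eq_bigr (fun=> q.+1)) => [|x _]; last first.
  by rewrite -(card_star x); apply: eq_card => i; rewrite !inE.
by rewrite !sum_nat_const !cardsT cX; nia.
Qed.

Lemma card_blkI_le1 (i j : I) : i != j -> #|blk i :&: blk j| <= 1.
Proof.
have [_ _ c2] := affine_plane => nij.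
apply/card_le1_eqP => x y; rewrite !inE => /andP[xi xj] /andP[yi yj].
apply/eqP; apply: contraT; rewrite eq_sym => /c2 c1.
have: #|[set i; j]| <= 1.
  by rewrite -c1; apply/subset_leq_card/subsetP => k /set2P[]->; rewrite inE ?xi ?yi ?xj ?yj.
by rewrite cards2 nij.
Qed.

Lemma card_missed (P : {set X}) :
  #|[set i | blk i :&: P != set0]| + #|missed_blocks blk P| = q * q.+1.
Proof.
rewrite -card_blocks -(cardsC (missed_blocks blk P)) addnC; congr (_ + _).
by apply: eq_card => i; rewrite !inE.
Qed.

(* After a first point of P, each further one adds at most q blocks, since it
   shares a block with the first. *)
Lemma card_met_le (P : {set X}) :
  #|[set i | blk i :&: P != set0]| <= (#|P| * q).+1.
Proof.
have [_ _ c2] := affine_plane.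
have [->|[x xP]] := set_0Vmem P.
  by rewrite eq_card0 // => i; rewrite !inE setI0 eqxx.
pose star y := [set i | y \in blk i].
have sub : [set i | blk i :&: P != set0] \subset
    star x :|: \bigcup_(y in P :\ x) (star y :\: star x).
  apply/subsetP => i; rewrite inE => /set0Pn[y /setIP[yi yP]].
  rewrite inE; case: (boolP (i \in star x)) => //= nxi.
  apply/bigcupP; exists y; last by rewrite !inE yi andbT; rewrite inE in nxi.
  by rewrite !inE yP andbT; apply: contraNneq nxi => <-; rewrite inE.
have le_bigcup : #|\bigcup_(y in P :\ x) (star y :\: star x)| <= #|P :\ x| * q.
  rewrite -sum_nat_const.
  elim/big_ind2: _ => [|m A n B Hm Hn|y]; first by rewrite cards0.
    by rewrite (leq_trans (leq_card_setU _ _)) ?leq_add.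
  rewrite !inE eq_sym => /andP[/c2 c1 _]; rewrite cardsD card_star.
  suff -> : star y :&: star x = [set i | (x \in blk i) && (y \in blk i)].
    by rewrite c1 subn1.
  by apply/setP => i; rewrite !inE andbC.
apply: leq_trans (subset_leq_card sub) _.
apply: leq_trans (leq_card_setU _ _) _.
by rewrite card_star (cardsD1 x P) xP; lia.
Qed.

(** The q points of [l] carry q(q + 1) incidences. Of these [l] accounts for q and any other block
    for at most one, so q^2 further blocks meet [l]. *)
Lemma card_met_blk_ge (l : I) :
  (q * q).+1 <= #|[set i | blk i :&: blk l != set0]|.
Proof.
have [_ cB _] := affine_plane.
have := sum_card_blk setT (blk l).
rewrite [RHS](eq_bigr (fun=> q.+1)) => [|x _]; last first.
  by rewrite -(card_star x); apply: eq_card => i; rewrite !inE.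
rewrite sum_nat_const cB (bigD1 l) ?inE //= setIid cB => E.
have lmet : l \in [set i | blk i :&: blk l != set0].
  by rewrite inE setIid -card_gt0 cB; lia.
rewrite (cardsD1 l) lmet.
suff : \sum_(i in setT | i != l) #|blk i :&: blk l| <=
       #|[set i | blk i :&: blk l != set0] :\ l| by lia.
rewrite -sum1_card big_mkcond [leqRHS]big_mkcond.
apply: leq_sum => i _; rewrite !inE /=.
case: eqVneq => //= nil; case: eqVneq => [->|_]; first by rewrite cards0.
exact: card_blkI_le1.
Qed.

Lemma card_vertices (S : {set X + I}) :
  #|S| = #|[set x | inl x \in S]| + #|[set i | inr i \in S]|.
Proof.
rewrite -!sum1_card big_mkcond big_sumType /=.
by congr (_ + _); rewrite [RHS]big_mkcond; apply: eq_bigr => a _; rewrite inE.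
Qed.

Lemma inl_neat_set (P : {set X}) (x : X) :
  (inl x \in neat_set blk P) = (x \in P).
Proof.
rewrite inE mem_imset; last by move=> ? ? [].
by rewrite orbC; case: imsetP => // -[].
Qed.

Lemma inr_neat_set (P : {set X}) (i : I) :
  (inr i \in neat_set blk P) = (i \in missed_blocks blk P).
Proof.
rewrite inE [X in _ || X]mem_imset; last by move=> ? ? [].
by case: imsetP => // -[].
Qed.

(* Playfair: only q of the q + 1 blocks through a point outside a block can
   meet that block. *)
Lemma parallel_through (l : I) (x : X) :
  x \notin blk l -> exists2 i, x \in blk i & i \in missed_blocks blk (blk l).
Proof.
have [_ cB c2] := affine_plane => xl.
apply/exists_inP; apply: contraT; rewrite negb_exists_in => /forall_inP all_met.
(* Each of the q points of [l] is joined to [x] by one block, which makes q incidences; q + 1 blocks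
   all meeting [l] would need more. *)
have := sum_card_blk [set i | x \in blk i] (blk l).
rewrite [RHS](eq_bigr (fun=> 1)) => [|y yl]; last first.
  have nxy : x != y by apply: contraNneq xl => ->.
  by rewrite -(c2 _ _ nxy); apply: eq_card => i; rewrite !inE.
have : \sum_(i in [set i | x \in blk i]) 1 <=
       \sum_(i in [set i | x \in blk i]) #|blk i :&: blk l|.
  apply: leq_sum => i; rewrite inE => /all_met.
  by rewrite inE -card_gt0.
by rewrite !sum1_card card_star cB => + E; rewrite E ltnn.
Qed.

(** The points of [l] dominate the blocks meeting [l]; the parallels of [l] dominate the points off
    it. *)
Lemma dominating_parallel_class (l : I) :
  dominating (incidence_graph blk) (neat_set blk (blk l)).
Proof.
apply/forallP => -[x|i]; apply/implyP.
  rewrite inl_neat_set => /parallel_through[i xi il].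
  by apply/exists_inP; exists (inr i); rewrite ?inr_neat_set.
rewrite inr_neat_set inE => /set0Pn[x /setIP[xi xl]].
by apply/exists_inP; exists (inl x); rewrite ?inl_neat_set.
Qed.

Lemma domination_number_affine_plane_le :
  domination_number (incidence_graph blk) <= (2 * q).-1.
Proof.
have [_ cB _] := affine_plane.
have [l _] : exists l : I, l \in I by apply/card_gt0P; rewrite card_blocks; lia.
apply: leq_trans (domination_number_le (dominating_parallel_class l)) _.
have -> : #|neat_set blk (blk l)| = #|blk l| + #|missed_blocks blk (blk l)|.
  rewrite card_vertices; congr (_ + _); apply: eq_card => a.
    by rewrite inE inl_neat_set.
  by rewrite [LHS]inE inr_neat_set.
(* At most q^2 + q - (q^2 + 1) = q - 1 blocks are parallel to [l]. *)
by have := card_met_blk_ge l; have := card_missed (blk l); rewrite cB; lia.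
Qed.

(** With p points in [P], the sum is at least q^2 + q - 1 - p(q - 1). This decreases in p and is
    still 3q - 2 >= 2q at p = q - 1. *)
Lemma card_points_ge (P : {set X}) :
  #|P| + #|missed_blocks blk P| < 2 * q -> q <= #|P|.
Proof.
by have := card_met_le P; have := card_missed P; nia.
Qed.

(** Each block of [L] covers at most q points outside [P], and [i] at most q - 1, as it spends a
    point inside [P]; hence the strict inequality. *)
Lemma card_covered_lt (P : {set X}) (L : {set I}) (i : I) :
    i \in L -> blk i :&: P != set0 ->
    (forall x, x \notin P -> exists2 j, j \in L & x \in blk j) ->
  q ^ 2 < #|L| * q + #|P|.
Proof.
have [cX cB _] := affine_plane => iL meet cov.
have := sum_card_blk L (~: P).
have : \sum_(x in ~: P) 1 <= \sum_(x in ~: P) #|[set j in L | x \in blk j]|.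
  apply: leq_sum => x; rewrite inE => /cov[j jL xj].
  by apply/card_gt0P; exists j; rewrite inE jL.
rewrite sum1_card => le_cov E; rewrite -{}E in le_cov.
have : \sum_(j in L) #|blk j :&: ~: P| < \sum_(j in L) q.
  rewrite !(bigD1 i iL) /= -addSn; apply: leq_add.
    by have := cardsID P (blk i); rewrite cB setDE -card_gt0 in meet *; lia.
  by apply: leq_sum => j _; rewrite -(cB j) subset_leq_card // subsetIl.
rewrite sum_nat_const; have := cardsC P; rewrite cX; lia.
Qed.

End AffinePlane.

Theorem theorem4p4 (q : nat) (X I : finType) (blk : I -> {set X}) :
  2 <= q -> is_2design blk (q ^ 2) q 1 -> super_neat blk.
Proof.
move=> q_ge2 ap S /andP[/forallP dom /eqP cS].
have := domination_number_affine_plane_le _ _ _ _ q_ge2 ap.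
rewrite -cS card_vertices.
set P := [set x | inl x \in S]; set L := [set i | inr i \in S] => leS.
(* No point of [S] dominates a block missing [P], so such a block is itself in [S]. *)
have missL : missed_blocks blk P \subset L.
  apply/subsetP => i; rewrite !inE => /eqP iP; apply: contraT => iS.
  have /exists_inP[[x|//] xS xi] := implyP (dom (inr i)) iS.
  by have := in_set0 x; rewrite -iP !inE xS andbT => <-.
have cov x : x \notin P -> exists2 j, j \in L & x \in blk j.
  rewrite inE => xS.
  have /exists_inP[[//|j] jS xj] := implyP (dom (inl x)) xS.
  by exists j; rewrite ?inE.
have qP : q <= #|P|.
  by apply: (card_points_ge _ _ _ _ q_ge2 ap); have := subset_leq_card missL; lia.
exists P; apply/setP => -[x|i]; first by rewrite inl_neat_set inE.
rewrite inr_neat_set; apply/idP/idP => [iS|/(subsetP missL)]; last by rewrite inE.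
rewrite inE; apply: contraT => meet.
have iL : i \in L by rewrite inE.
(* From |L| <= 2q - 1 - |P| and |P| >= q follows |L|q + |P| <= q(2q - 1) - q(q - 1) = q^2, a
   contradiction. *)
by have := card_covered_lt _ _ _ _ q_ge2 ap _ _ _ iL meet cov; nia.
Qed.
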